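(* Let $q$ be a prime with $q\equiv 3 \pmod 8$, let $\alpha\in\mathbb{Z}_q$ be a generator of the multiplicative group $QR(q)$ of nonzero quadratic residues modulo $q$, and let $\beta\in\{2,\frac{q+1}{2}\}$. Then the set $$S_\beta=\left\{\{\alpha,\beta\alpha\},\{\alpha^2,\beta\alpha^2\},\ldots,\{\alpha^{\frac{q-1}{2}},\beta\alpha^{\frac{q-1}{2}}\}\right\}$$ (with all arithmetic in $\mathbb{Z}_q$) is a strong starter for $\mathbb{Z}_q$ that is Skolem; i.e., $S_\beta$ is a strong Skolem starter for $\mathbb{Z}_q$.
   Context: Let $G$ be a finite additive abelian group of odd order $n=2t+1$ and $G^*=G\setminus\{0\}$. A starter for $G$ is a set $S=\{\{x_1,y_1\},\ldots,\{x_t,y_t\}\}$ of unordered pairs such that $\{x_1,\ldots,x_t,y_1,\ldots,y_t\}=G^*$ and $\{\pm(x_i-y_i): i=1,\ldots,t\}=G^*$. It is a strong starter if moreover the sums $x_1+y_1,\ldots,x_t+y_t$ are pairwise distinct (i.e. $|\{x_i+y_i\}|=t$). For $G=\mathbb{Z}_n$, identify the nonzero elements with the integers $1,\ldots,2t$ ordered by $1<2<\cdots<2t$. A starter for $\mathbb{Z}_n$ is Skolem if its pairs can be written as $\{x_i,y_i\}$, $i=1,\ldots,t$, with $y_i>x_i$ (in this order) and $y_i-x_i\equiv i \pmod n$ for each $i=1,\ldots,t$. A strong Skolem starter is a starter that is both strong and Skolem. $QR(q)$ denotes the set of nonzero squares in $\mathbb{Z}_q$, a cyclic group of order $\frac{q-1}{2}$.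 *)

(* Defs.v *)
From HB Require Import structures.
From mathcomp Require Import all_boot all_order all_fingroup all_algebra all_solvable.

Set Implicit Arguments.
Unset Strict Implicit.
Unset Printing Implicit Defensive.

Import GRing.Theory.
Local Open Scope ring_scope.

(* S = {{x_0,y_0},...,{x_(t-1),y_(t-1)}} is a starter for G. Each of the two
   set equalities forces, since #|G| = 2t + 1, that no repetition occurs. *)
Definition starter_listing (G : finZmodType) (S : {set {set G}})
    (t : nat) (x y : 'I_t -> G) : Prop :=
  [/\ #|G| = t.*2.+1,
      S = [set [set x i; y i] | i : 'I_t],
      [set x i | i : 'I_t] :|: [set y i | i : 'I_t] = [set~ 0] &
      [set x i - y i | i : 'I_t] :|: [set - (x i - y i) | i : 'I_t] = [set~ 0]].

Definition starter (G : finZmodType) (S : {set {set G}}) : Prop :=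
  exists (t : nat) (x y : 'I_t -> G), starter_listing S x y.

Definition strong_starter (G : finZmodType) (S : {set {set G}}) : Prop :=
  exists (t : nat) (x y : 'I_t -> G),
    starter_listing S x y /\ injective (fun i => x i + y i).

(* The index i : 'I_t starts at 0, hence the difference i.+1; the order is that
   of the representatives 0, ..., n - 1. The listing forces #|'Z_n| to be odd,
   which excludes n = 0 and n = 1, where 'Z_n is not Z/nZ. *)
Definition skolem_starter (n : nat) (S : {set {set 'Z_n}}) : Prop :=
  exists (t : nat) (x y : 'I_t -> 'Z_n),
    starter_listing S x y /\
    forall i : 'I_t, (x i < y i)%N /\ y i - x i = i.+1%:R.

Definition strong_skolem_starter (n : nat) (S : {set {set 'Z_n}}) : Prop :=
  strong_starter S /\ skolem_starter S.

Definition QR (q : nat) : {set 'Z_q} :=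
  [set x : 'Z_q | (x != 0) && [exists y : 'Z_q, x == y ^+ 2]].

(* QR q inside the group of units of 'Z_q; for q prime no element is lost. *)
Definition QR_units (q : nat) : {set {unit 'Z_q}} :=
  [set u : {unit 'Z_q} | val u \in QR q].

Definition S_set (q : nat) (alpha beta : 'Z_q) : {set {set 'Z_q}} :=
  [set [set alpha ^+ i.+1; beta * alpha ^+ i.+1] | i : 'I_((q - 1) %/ 2)].

(* Main.v *)
Require Import Defs.
From HB Require Import structures.
From mathcomp Require Import all_boot all_order all_fingroup all_algebra all_solvable.
From mathcomp Require Import zify.

Import GRing.Theory.
Local Open Scope ring_scope.

(** Let [t = (q - 1) / 2], which is odd. Then [QR q] consists of the [x] with
    [x ^+ t = 1], and [2 ^+ t = -1] by Gauss's lemma, so multiplication by -1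
    and by 2 both exchange residues and nonresidues. In both cases [S_beta] is
    the set of pairs [{s, 2s}] with [s] in a set [Q] (residues if [beta = 2],
    nonresidues if [beta = 1/2]) such that [Q], [-Q] as well as [Q], [2Q]
    partition the nonzero elements. For each [i = 1, ..., t] exactly one of
    [i], [-i] lies in [Q]; it yields the pair [i < 2i], resp. [q - 2i < q - i],
    whose integer difference is [i] and whose sum is [3s]. When [q = 3] the
    factor 3 is not invertible, but then there is a single pair. *)

Lemma natr_Zp_eq0 (q : nat) : (1 < q)%N -> q%:R = 0 :> 'Z_q.
Proof. by move=> q1; apply: val_inj; rewrite /= val_Zp_nat // modnn. Qed.

Lemma natr_Zp_neq0 (q n : nat) : (0 < n < q)%N -> n%:R != 0 :> 'Z_q.
Proof.
move=> nq; apply/eqP => /(congr1 val).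
by rewrite /= val_Zp_nat ?modn_small; lia.
Qed.

Lemma natr_Zp_half (q t : nat) :
  (1 < q)%N -> q = t.*2.+1 -> 2%:R * t.+1%:R = 1 :> 'Z_q.
Proof.
move=> q1 qE; rewrite -natrM.
have -> : (2 * t.+1 = q + 1)%N by lia.
by rewrite natrD natr_Zp_eq0 // add0r.
Qed.

(** * A Skolem starter from a set [Q] that both negation and doubling exchange with its
    complement *)

Section OneOfEachOpposite.

Variables (q t : nat) (Q : {set 'Z_q}).
Hypotheses (q_gt1 : (1 < q)%N) (qE : q = t.*2.+1).
Hypothesis Q0 : 0 \notin Q.
Hypothesis QN : forall x : 'Z_q, x != 0 -> (- x \in Q) = (x \notin Q).
Hypothesis Q2 : forall x : 'Z_q, x != 0 -> (2%:R * x \in Q) = (x \notin Q).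

Definition signed_rep (i : 'I_t) : 'Z_q :=
  if i.+1%:R \in Q then i.+1%:R else - i.+1%:R.
Definition skolem_lo (i : 'I_t) : 'Z_q :=
  if i.+1%:R \in Q then signed_rep i else 2%:R * signed_rep i.
Definition skolem_hi (i : 'I_t) : 'Z_q :=
  if i.+1%:R \in Q then 2%:R * signed_rep i else signed_rep i.

Lemma ord_natr_neq0 (i : 'I_t) : i.+1%:R != 0 :> 'Z_q.
Proof. by apply: natr_Zp_neq0; have := ltn_ord i; lia. Qed.

Lemma signed_rep_in (i : 'I_t) : signed_rep i \in Q.
Proof.
rewrite /signed_rep; case: ifPn => // iQ.
by rewrite QN // ord_natr_neq0.
Qed.

Lemma ord_natr_inj (i j : 'I_t) : i.+1%:R = j.+1%:R :> 'Z_q -> i = j.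
Proof.
move=> /(congr1 val); rewrite /= !val_Zp_nat // !modn_small;
  by have := (ltn_ord i, ltn_ord j); move=> [] *; try (apply: val_inj => /=); lia.
Qed.

Lemma signed_rep_inj : injective signed_rep.
Proof.
(* Equality would make the sum of two numbers in [1..t] vanish, but it lies between 2 and
   [2t = q - 1]. *)
have neq (i j : 'I_t) : i.+1%:R <> - j.+1%:R :> 'Z_q.
  move=> /(congr1 (fun x => x + j.+1%:R)); rewrite addNr -natrD.
  by apply/eqP/natr_Zp_neq0; have := (ltn_ord i, ltn_ord j); move=> [] *; lia.
move=> i j; rewrite /signed_rep; case: ifP => _; case: ifP => _.
- exact: ord_natr_inj.
- by move/neq.
- by move/esym/neq.
- by move/oppr_inj/ord_natr_inj.
Qed.

Lemma ord_natr_opp_cover (r : 'Z_q) :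
  r != 0 -> exists i : 'I_t, r = i.+1%:R \/ r = - i.+1%:R.
Proof.
move=> r0; have rlt : (r < q)%N by have := ltn_ord r; rewrite {2}Zp_cast.
have r_gt0 : (0 < r)%N by rewrite lt0n; apply: contra r0 => /eqP h; apply/eqP/val_inj.
have [rt|rt] := leqP r t.
  have lt : (r.-1 < t)%N by lia.
  by exists (Ordinal lt); left; rewrite /= prednK // natr_Zp.
(* Here [-r] has representative [q - r <= t]; indices start at 0, whence [q - r - 1]. *)
have lt : (q - r.+1 < t)%N by lia.
exists (Ordinal lt); right; rewrite /= -subSn // subSS.
by rewrite natrB 1?ltnW // natr_Zp_eq0 // natr_Zp sub0r opprK.
Qed.

Lemma signed_rep_surj (r : 'Z_q) : r \in Q -> exists i, r = signed_rep i.
Proof.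
move=> rQ; have r0 : r != 0 by apply: contraNneq Q0 => <-.
have [i [rE|rE]] := ord_natr_opp_cover r r0; exists i; rewrite /signed_rep.
  by rewrite -rE rQ.
by move: rQ; rewrite rE QN ?ord_natr_neq0 // => /negbTE->.
Qed.

Lemma skolem_diff (i : 'I_t) : skolem_hi i - skolem_lo i = i.+1%:R.
Proof.
rewrite /skolem_hi /skolem_lo /signed_rep; case: (_ \in Q).
  by rewrite mulr_natl mulr2n addrK.
by rewrite mulr_natl mulr2n opprD addNKr opprK.
Qed.

Lemma skolem_sum (i : 'I_t) : skolem_lo i + skolem_hi i = 3%:R * signed_rep i.
Proof.
rewrite /skolem_hi /skolem_lo; case: (_ \in Q); last rewrite addrC.
all: by rewrite !mulr_natl [RHS]mulrS.
Qed.

(** Since [2(i + 1) <= 2t < q], no doubling wraps around, and representatives compare as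
    integers. *)
Lemma skolem_lt (i : 'I_t) : (skolem_lo i < skolem_hi i)%N.
Proof.
have it := ltn_ord i; rewrite /skolem_hi /skolem_lo /signed_rep.
case: (_ \in Q); first by rewrite -natrM !val_Zp_nat // !modn_small; lia.
have oppE m : (m <= q)%N -> - m%:R = (q - m)%:R :> 'Z_q.
  by move=> mq; rewrite natrB // natr_Zp_eq0 // sub0r.
rewrite mulrN -natrM !oppE; try lia.
by rewrite !val_Zp_nat // !modn_small; lia.
Qed.

Lemma skolem_listing :
  starter_listing [set [set s; 2%:R * s] | s in Q] skolem_lo skolem_hi.
Proof.
split.
- by rewrite card_ord Zp_cast.
- apply/setP => A; apply/imsetP/imsetP => [[s sQ ->]|[i _ ->]].
    have [i ->] := signed_rep_surj s sQ; exists i => //.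
    by rewrite /skolem_lo /skolem_hi; case: (_ \in Q) => //; rewrite setUC.
  exists (signed_rep i); first exact: signed_rep_in.
  by rewrite /skolem_lo /skolem_hi; case: (_ \in Q) => //; rewrite setUC.
- have two_neq0 x : 2%:R * x = 0 -> x = 0 :> 'Z_q.
    move=> x0; rewrite -[x]mul1r -(natr_Zp_half q t q_gt1 qE).
    by rewrite mulrAC x0 mul0r.
  have rep_neq0 i : signed_rep i != 0.
    by apply: contraNneq Q0 => <-; exact: signed_rep_in.
  have rep2_neq0 i : 2%:R * signed_rep i != 0.
    by apply: contraNneq (rep_neq0 i) => /two_neq0 ->.
  apply/setP => u; rewrite !inE; apply/orP/idP => [|u0].
    by case=> /imsetP[i _ ->]; rewrite /skolem_lo /skolem_hi; case: ifP.
  have [uQ|uQ] := boolP (u \in Q).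
    have [i uE] := signed_rep_surj u uQ.
    have [iQ|iQ] := boolP (i.+1%:R \in Q); [left|right]; apply/imsetP; exists i => //.
      by rewrite /skolem_lo iQ.
    by rewrite /skolem_hi (negbTE iQ).
  (* Outside [Q], [u] is the doubled entry of a pair: by [Q2] its half [(t + 1) u] lies in [Q]. *)
  have uE : u = 2%:R * (t.+1%:R * u) by rewrite mulrA (natr_Zp_half q t q_gt1 qE) mul1r.
  have hu0 : t.+1%:R * u != 0.
    by apply: contraNneq u0 => h; rewrite uE h mulr0.
  have huQ : t.+1%:R * u \in Q by move: uQ; rewrite {1}uE Q2 // negbK.
  have [i hE] := signed_rep_surj _ huQ.
  have [iQ|iQ] := boolP (i.+1%:R \in Q); [right|left]; apply/imsetP; exists i => //.
    by rewrite /skolem_hi iQ uE hE.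
  by rewrite /skolem_lo (negbTE iQ) uE hE.
- apply/setP => u; rewrite !inE; apply/orP/idP => [|u0].
    case=> /imsetP[i _ ->]; first by rewrite -opprB oppr_eq0 skolem_diff ord_natr_neq0.
    by rewrite opprB skolem_diff ord_natr_neq0.
  (* A listing takes the differences [x - y], here [-(i + 1)], so positive values come from the
     negated family. *)
  have [i [uE|uE]] := ord_natr_opp_cover u u0; [right|left]; apply/imsetP; exists i => //.
    by rewrite opprB skolem_diff.
  by rewrite -opprB skolem_diff.
Qed.

Lemma doubling_strong_skolem :
  (t <= 1)%N \/ injective (fun x : 'Z_q => 3%:R * x) ->
  strong_skolem_starter [set [set s; 2%:R * s] | s in Q].
Proof.
move=> h; split; exists t, skolem_lo, skolem_hi; split.
- exact: skolem_listing.
- move=> i j; rewrite !skolem_sum; case: h => [t1 _|inj3 /inj3/signed_rep_inj //].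
  by apply: val_inj; have := (ltn_ord i, ltn_ord j); move=> [] /= *; lia.
- exact: skolem_listing.
- by move=> i; split; [exact: skolem_lt|exact: skolem_diff].
Qed.

End OneOfEachOpposite.

(** * Gauss's lemma for 2, in product form *)

(** Separates [(2m + 1)!] into odd and even factors, so that the even ones can be matched with those
    of [2^t t!]. *)
Lemma prod_odd_even (R : comPzRingType) (m : nat) :
  (\prod_(j < m.+1) (j.*2.+1)%:R) * (\prod_(i < m) (i.+1.*2)%:R) =
  \prod_(i < m.*2.+1) i.+1%:R :> R.
Proof.
elim: m => [|m IH]; first by rewrite !big_ord_recr !big_ord0 /= !mul1r.
rewrite doubleS big_ord_recr [X in _ * X]big_ord_recr /= mulrACA IH.
by rewrite [RHS]big_ord_recr [in RHS]big_ord_recr /= -mulrA [X in _ * X]mulrC doubleS.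
Qed.

(* Gauss's lemma for 2: modulo 8k+3, the even numbers 4k+2, ..., 8k+2 are the
   opposites of the odd numbers 1, ..., 4k+1. *)
Lemma prod_double (R : comPzRingType) (k : nat) : (8 * k + 3)%:R = 0 :> R ->
  2%:R ^+ (4 * k).+1 * \prod_(i < (4 * k).+1) i.+1%:R =
  - \prod_(i < (4 * k).+1) i.+1%:R :> R.
Proof.
move=> char0.
have -> : 2%:R ^+ (4 * k).+1 * \prod_(i < (4 * k).+1) i.+1%:R
        = \prod_(i < (4 * k).+1) (i.+1.*2)%:R :> R.
  rewrite -[X in 2%:R ^+ X]card_ord -prodr_const -big_split /=.
  by apply: eq_bigr => i _; rewrite -natrM mul2n.
rewrite (_ : (4 * k).+1 = (k.*2).*2.+1)%N; last by lia.
rewrite -[X in - X]prod_odd_even.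
rewrite -(big_mkord xpredT (fun i => (i.+1.*2)%:R : R)).
(* The first [2k] even factors [2, ..., 4k] occur on both sides; the [2k + 1] others must give the
   odd product up to sign. *)
rewrite (@big_cat_nat _ _ _ k.*2) //=; last by lia.
rewrite big_mkord mulrC -mulNr; congr (_ * _).
rewrite -{1}[k.*2]add0n big_addn big_mkord.
have -> : (k.*2.*2.+1 - k.*2 = k.*2.+1)%N by lia.
(* In reverse order, [8k + 2 - 2i] faces [2i + 1], and the two sum to [8k + 3 = 0]. The number of
   factors is odd, so the signs multiply to -1. *)
rewrite (reindex_inj rev_ord_inj) /=.
have -> : - \prod_(j < k.*2.+1) (j.*2.+1)%:R
   = (-1) ^+ k.*2.+1 * \prod_(j < k.*2.+1) (j.*2.+1)%:R :> R.
  by rewrite exprS -mul2n exprM sqrrN !expr1n mulr1 mulN1r.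
rewrite -[X in _ ^+ X]card_ord -prodr_const -big_split /=.
apply: eq_bigr => i _; apply/eqP; rewrite mulN1r -addr_eq0 -natrD.
by rewrite -[X in _ == X]char0; apply/eqP; congr (_%:R); have := ltn_ord i; lia.
Qed.

(** * Euler's criterion modulo a prime [q = 8k + 3], and the two starters *)

Section PrimeModulus.

Variables (q k : nat).
Hypotheses (q_prime : prime q) (qE : q = (8 * k + 3)%N).
Let t := (4 * k).+1.
Let q_gt1 : (1 < q)%N := prime_gt1 q_prime.

Lemma Zp_prime_unit (x : 'Z_q) : x != 0 -> x \is a GRing.unit.
Proof.
move=> x0; rewrite -[x]natr_Zp unitZpE // prime_coprime // gtnNdvd //.
  by rewrite lt0n; apply: contra x0 => /eqP h; apply/eqP/val_inj.
by have := ltn_ord x; rewrite {2}Zp_cast.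
Qed.

Lemma Zp_prime_mulf_eq0 (x y : 'Z_q) : x * y = 0 -> x = 0 \/ y = 0.
Proof.
have [->|/Zp_prime_unit ux] := eqVneq x 0; first by left.
by move=> xy0; right; rewrite -[y](mulKr ux) xy0 mulr0.
Qed.

(** Fermat's little theorem [x ^+ q = x] with one factor [x] cancelled, as [q = 2t + 1]. *)
Lemma Zp_prime_expf (x : 'Z_q) : x != 0 -> x ^+ t.*2 = 1.
Proof.
move=> x0; rewrite -(mulKr (Zp_prime_unit x x0) (x ^+ _)) -exprS.
have -> : t.*2.+1 = q by rewrite /t; lia.
suff -> : x ^+ q = x by rewrite mulVr // Zp_prime_unit.
apply: val_inj; rewrite -{1}[x]natr_Zp -natrX /= val_Zp_nat //.
by rewrite fermat_little // modn_small //; have := ltn_ord x; rewrite {2}Zp_cast.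
Qed.

Lemma Zp_prime_one_neqN1 : 1 != -1 :> 'Z_q.
Proof.
rewrite -addr_eq0 (_ : 1 + 1 = 2%:R) //.
by apply: natr_Zp_neq0; lia.
Qed.

Lemma Zp_prime_half_exp (x : 'Z_q) : x != 0 -> x ^+ t = 1 \/ x ^+ t = -1.
Proof.
move=> x0; have : (x ^+ t - 1) * (x ^+ t + 1) = 0.
  by rewrite -subr_sqr_1 -exprM muln2 Zp_prime_expf // subrr.
case/Zp_prime_mulf_eq0 => /eqP; first by rewrite subr_eq0 => /eqP; left.
by rewrite addr_eq0 => /eqP; right.
Qed.

Lemma exprN_t (x : 'Z_q) : (- x) ^+ t = - x ^+ t.
Proof. by rewrite exprNn -signr_odd /t oddS oddM expr1 mulN1r. Qed.

(** All factors of [t!] are below [q], so [t!] is a unit and cancels from [prod_double]. *)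
Lemma two_exp_t : 2%:R ^+ t = -1 :> 'Z_q.
Proof.
have u : \prod_(i < t) i.+1%:R \is a @GRing.unit 'Z_q.
  apply: rpred_prod => i _; apply: Zp_prime_unit; apply: natr_Zp_neq0.
  by have := ltn_ord i; rewrite /t; lia.
apply: (mulIr u); rewrite mulN1r; apply: prod_double.
by rewrite -qE natr_Zp_eq0.
Qed.

(* As t is odd, [x ^+ t = 1] exhibits [x = (x ^+ (t.+1 / 2)) ^+ 2]. *)
Lemma in_QR (x : 'Z_q) : (x \in QR q) = (x ^+ t == 1).
Proof.
rewrite inE; apply/andP/eqP => [[x0 /existsP[y /eqP xE]]|xt].
  rewrite xE -exprM mul2n Zp_prime_expf //.
  by apply: contraNneq x0 => y0; rewrite xE y0 expr0n.
split.
  apply/eqP => x0; move: xt; rewrite x0 expr0n /= => /eqP.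
  by rewrite eq_sym oner_eq0.
apply/existsP; exists (x ^+ (k.*2).+1); apply/eqP; rewrite -exprM.
by rewrite -[LHS]mulr1 -xt -exprS /t; congr (_ ^+ _); lia.
Qed.

(** The nonresidues by Euler's criterion; unlike the complement of [QR q], this set omits 0. *)
Definition nonQR : {set 'Z_q} := [set x | x ^+ t == -1].

Lemma zero_exp_t : 0 ^+ t = 0 :> 'Z_q.
Proof. by rewrite expr0n. Qed.

Lemma three_inj : (t <= 1)%N \/ injective (fun x : 'Z_q => 3%:R * x).
Proof.
have [t1|t1] := leqP t 1; [by left|right; apply: mulrI].
apply: Zp_prime_unit; apply: natr_Zp_neq0.
by move: t1; rewrite /t; lia.
Qed.

Lemma QR_strong_skolem :
  strong_skolem_starter [set [set s; 2%:R * s] | s in QR q].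
Proof.
have h := Zp_prime_one_neqN1.
apply: (@doubling_strong_skolem q t) three_inj => //.
- by rewrite /t; lia.
- by rewrite in_QR zero_exp_t eq_sym oner_eq0.
- move=> x x0; rewrite !in_QR exprN_t.
  by case: (Zp_prime_half_exp x x0) => ->; rewrite ?opprK !eqxx eq_sym ?(negbTE h) // eq_sym h.
- move=> x x0; rewrite !in_QR exprMn two_exp_t mulN1r.
  by case: (Zp_prime_half_exp x x0) => ->; rewrite ?opprK !eqxx eq_sym ?(negbTE h) // eq_sym h.
Qed.

Lemma nonQR_strong_skolem :
  strong_skolem_starter [set [set s; 2%:R * s] | s in nonQR].
Proof.
have h := Zp_prime_one_neqN1.
apply: (@doubling_strong_skolem q t) three_inj => //.
- by rewrite /t; lia.
- by rewrite inE zero_exp_t eq_sym oppr_eq0 oner_eq0.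
- move=> x x0; rewrite !inE exprN_t.
  by case: (Zp_prime_half_exp x x0) => ->; rewrite ?opprK !eqxx ?(negbTE h) // h.
- move=> x x0; rewrite !inE exprMn two_exp_t mulN1r.
  by case: (Zp_prime_half_exp x x0) => ->; rewrite ?opprK !eqxx ?(negbTE h) // h.
Qed.

(** The residues are the powers of [alpha], and [alpha ^+ t = 1] lets every exponent be reduced to
    the range [1..t]. *)
Lemma S_setE (alpha : {unit 'Z_q}) (beta : 'Z_q) :
  generator (QR_units q) alpha ->
  S_set (val alpha) beta = [set [set r; beta * r] | r in QR q].
Proof.
move=> /eqP gen.
have powE n : val (alpha ^+ n)%g = val alpha ^+ n by exact: FinRing.val_unitX.
have aQ : val alpha ^+ t = 1.
  by apply/eqP; rewrite -in_QR; have := cycle_id alpha; rewrite -gen inE.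
have tE : ((q - 1) %/ 2 = t)%N by rewrite /t; lia.
rewrite /S_set tE; apply/setP => A; apply/imsetP/imsetP => [[i _ ->]|[r rQ ->]].
  exists (val alpha ^+ i.+1) => //.
  by rewrite in_QR -exprM mulnC exprM aQ expr1n.
have r0 : r != 0 by move: rQ; rewrite inE => /andP[].
have : FinRing.Unit (Zp_prime_unit r r0) \in <[alpha]>%g by rewrite -gen inE.
case/cycleP => n /(congr1 val); rewrite powE /= => rE.
(* Index [i] carries exponent [i + 1], so the index sought is [n - 1] modulo [t]; adding [t - 1]
   instead avoids truncated subtraction at [n = 0]. *)
have lt : ((n + t.-1) %% t < t)%N by rewrite ltn_mod.
exists (Ordinal lt) => //=.
suff -> : r = val alpha ^+ ((n + t.-1) %% t).+1 by [].
have expm m : val alpha ^+ (m %% t) = val alpha ^+ m.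
  by rewrite {2}(divn_eq m t) exprD mulnC exprM aQ expr1n mul1r.
by rewrite exprS expm -exprS -addnS prednK // exprD aQ mulr1.
Qed.

(* The pair {r, r/2} is {s, 2s} for the nonresidue s = r/2. *)
Lemma half_pairsE :
  [set [set r; ((q + 1) %/ 2)%:R * r] | r in QR q] =
  [set [set s; 2%:R * s] | s in nonQR].
Proof.
have -> : ((q + 1) %/ 2 = t.+1)%N by rewrite /t; lia.
have half : 2%:R * t.+1%:R = 1 :> 'Z_q.
  by apply: natr_Zp_half => //; rewrite /t; lia.
have twice (r : 'Z_q) : 2%:R * (t.+1%:R * r) = r by rewrite mulrA half mul1r.
apply/setP => A; apply/imsetP/imsetP => [[r rQ ->]|[s sN ->]].
  exists (t.+1%:R * r); last by rewrite twice setUC.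
  move: rQ; rewrite in_QR inE -{1}[r]twice exprMn two_exp_t mulN1r.
  by rewrite eqr_oppLR.
exists (2%:R * s); last by rewrite mulrCA twice setUC.
by move: sN; rewrite inE in_QR exprMn two_exp_t mulN1r eqr_oppLR.
Qed.

End PrimeModulus.

Theorem mainTheorem1 (q : nat) (hq : prime q) (hq8 : q = 3 %[mod 8])
    (alpha : {unit 'Z_q}) (halpha : generator (QR_units q) alpha)
    (beta : 'Z_q) (hbeta : beta = 2%:R \/ beta = ((q + 1) %/ 2)%:R) :
  strong_skolem_starter (S_set (val alpha) beta).
Proof.
have qE : q = (8 * (q %/ 8) + 3)%N by lia.
rewrite (S_setE _ _ hq qE _ _ halpha); case: hbeta => ->.
  exact: QR_strong_skolem hq qE.
rewrite (half_pairsE _ _ hq qE); exact: nonQR_strong_skolem.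
Qed.
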